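(* Let $k$ be a field and let $A$ be an Artinian $k$-algebra which is splitting over $k$, with Jacobson radical $r$ and block decomposition $A/r=\bigoplus_{i=1}^{s}A_i$ into two-sided simple ideals, $A_i\cong M_{n_i}(k)$. Let $\Gamma_A$ be the Ext-quiver of $A$ and $\Delta_A$ the natural quiver of $A$, both with vertex set $\{1,\dots,s\}$. Then for all $i,j\in\{1,\dots,s\}$, $$t_{ij}=\left\lceil \frac{m_{ij}}{n_in_j}\right\rceil ,$$ where $t_{ij}$ is the number of arrows from $i$ to $j$ in $\Delta_A$ and $m_{ij}$ is the number of arrows from $i$ to $j$ in $\Gamma_A$.
   Context: Artinian means left Artinian; modules are left modules. Let $S_1,\dots,S_s$ be the complete set of non-isomorphic irreducible $A$-modules, indexed so that $S_i$ is the irreducible module of the block $A_i$. $A$ is splitting over $k$ ($k$-splitting) if $\dim_k \mathrm{End}_A(S_i)=1$ for all $i$; then $A_i\cong M_{n_i}(k)$ with $n_i=\dim_k S_i$. Ext-quiver $\Gamma_A$ (for $k$-splitting $A$): vertex set $\{1,\dots,s\}$, with $m_{ij}=\dim_k \mathrm{Ext}^1_A(S_i,S_j)$ arrows from $i$ to $j$. Natural quiver $\Delta_A$: vertex set $\{1,\dots,s\}$; put ${}_jM_i=A_j\cdot (r/r^2)\cdot A_i$, an $A_j$-$A_i$-bimodule (with $k$ acting centrally). The number $t_{ij}$ of arrows from $i$ to $j$ is the minimal number of generators of ${}_jM_i$ as an $A_j$-$A_i$-bimodule (equal to $0$ if ${}_jM_i=0$). For a real number $a$, $\lceil a\rceil=\min\{n\in\mathbb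 Z : n\ge a\}$. *)

(* Defs.v *)
From HB Require Import structures.
From mathcomp Require Import all_boot all_order all_algebra.
From mathcomp Require Import boolp classical_sets functions.
From mathcomp Require Import freeg.

Set Implicit Arguments.
Unset Strict Implicit.
Unset Printing Implicit Defensive.

Import Order.TTheory GRing.Theory Num.Theory.

Local Open Scope classical_set_scope.
Local Open Scope ring_scope.

(* [dim_quotient Z B m]: for subspaces B `<=` Z of V, the quotient Z / B has
   dimension m over k, i.e. some family of m vectors of Z induces a basis of
   Z / B. *)
Definition dim_quotient (k : fieldType) (V : lmodType k) (Z B : set V)
    (m : nat) : Prop :=
  exists b : 'I_m -> V,
    (forall l, Z (b l)) /\
    (forall v, Z v ->
       exists! c : 'rV[k]_m, B (v - \sum_(l < m) c 0 l *: b l)).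

Section Ideals.
Variable R : nzRingType.

Definition add_subgroup (V : zmodType) (G : set V) : Prop :=
  G 0 /\ (forall x y, G x -> G y -> G (x - y)).

Definition left_ideal (I : set R) : Prop :=
  add_subgroup I /\ (forall a x, I x -> I (a * x)).

Definition two_sided_ideal (I : set R) : Prop :=
  left_ideal I /\ (forall x a, I x -> I (x * a)).

Definition left_artinian : Prop :=
  forall I : nat -> set R,
    (forall n, left_ideal (I n)) -> (forall n, I n.+1 `<=` I n) ->
    exists N, forall n, (N <= n)%N -> I n = I N.

Definition maximal_left_ideal (I : set R) : Prop :=
  [/\ left_ideal I, I <> setT &
      forall J, left_ideal J -> I `<=` J -> J = I \/ J = setT].

Definition jacobson_radical : set R :=
  \bigcap_(I in maximal_left_ideal) I.

(* The product of I and J: all finite sums of products. *)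
Definition ideal_mul (I J : set R) : set R :=
  smallest (@add_subgroup R) [set x | exists2 a, I a & exists2 b, J b & x = a * b].

Definition minimal_two_sided_ideal (I : set R) : Prop :=
  [/\ two_sided_ideal I, I <> [set 0] &
      forall J, two_sided_ideal J -> J `<=` I -> J = [set 0] \/ J = I].

Definition ideal_direct_sum (s : nat) (I : 'I_s -> set R) : Prop :=
  forall x : R, exists! y : {ffun 'I_s -> R},
    (forall i, I i (y i)) /\ x = \sum_(i < s) y i.

Definition block_decomposition (s : nat) (I : 'I_s -> set R) : Prop :=
  (forall i, minimal_two_sided_ideal (I i)) /\ ideal_direct_sum I.

End Ideals.

Section Modules.
Variable A : nzRingType.

Definition submodule (M : lmodType A) (N : set M) : Prop :=
  add_subgroup N /\ (forall a x, N x -> N (a *: x)).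

Definition irreducible_module (M : lmodType A) : Prop :=
  [set: M] <> [set 0] /\
  (forall N : set M, submodule N -> N = [set 0] \/ N = setT).

Definition module_iso (M N : lmodType A) : Prop :=
  exists f : {linear M -> N}, bijective f.

Definition complete_irreducibles (s : nat) (S : 'I_s -> lmodType A) : Prop :=
  [/\ forall i, irreducible_module (S i),
      forall i j, module_iso (S i) (S j) -> i = j &
      forall M : lmodType A, irreducible_module M ->
        exists i, module_iso M (S i)].

Definition projective_module (P : lmodType A) : Prop :=
  forall (M N : lmodType A) (g : {linear M -> N}) (f : {linear P -> N}),
    (forall y, exists x, g x = y) ->
    exists h : {linear P -> M}, forall x, g (h x) = f x.

Record projective_resolution (M : lmodType A) := ProjectiveResolution {
  res_obj : nat -> lmodType A;
  res_diff : forall n, {linear res_obj n.+1 -> res_obj n};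
  res_aug : {linear res_obj 0%N -> M};
  res_projective : forall n, projective_module (res_obj n);
  res_aug_surj : forall y, exists x, res_aug x = y;
  res_exact_aug :
    forall x, res_aug x = 0 <-> exists y, res_diff 0%N y = x;
  res_exact :
    forall n x, res_diff n x = 0 <-> exists y, res_diff n.+1 y = x }.

End Modules.

Section FreeResolution.
Variable A : nzRingType.

Lemma fglift_is_linear (K : choiceType) (N : lmodType A) (f : K -> N) :
  linear (fglift f : {freeg K / A} -> N).
Proof.
pose fA := GRing.isAdditive.Build _ _ _ (lift_is_additive f).
pose g : {additive {freeg K / A} -> N} := HB.pack (fglift f : {freeg K / A} -> N) fA.
have gE D : fglift f D = g D by [].
move=> c D E; rewrite gE raddfD /=; congr (_ + _).
have -> : c *: D = \sum_(x <- dom D) << c * coeff x D *g x >> by [].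
rewrite -[in RHS](freeg_sumE D) !gE (raddf_sum g) (raddf_sum g) scaler_sumr.
by apply: eq_bigr => x _; rewrite -!gE !liftU scalerA.
Qed.

HB.instance Definition _ (K : choiceType) (N : lmodType A) (f : K -> N) :=
  GRing.isLinear.Build A {freeg K / A} N *:%R (fglift f) (fglift_is_linear f).

Lemma free_projective (K : choiceType) : projective_module {freeg K / A}.
Proof.
move=> M N g f gs.
pose m x := projT1 (cid (gs (f << x >>))).
exists (fglift m) => D; rewrite -[D]freeg_sumE !linear_sum.
apply: eq_bigr => x _ /=; rewrite liftU linearZ /= /m.
case: cid => y /= ->; rewrite -linearZ /=; congr (f _).
by apply/eqP/freeg_eqP => z; rewrite coeffZ !coeffU mul1r.
Qed.

Section Kernel.
Variables (M N : lmodType A) (f : {linear M -> N}).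
Definition lker_pred : {pred M} := [pred x | f x == 0].
Fact lker_submod : submod_closed lker_pred.
Proof.
split=> [|a x y]; rewrite !inE ?linear0 // => /eqP fx /eqP fy.
by rewrite linearP fx fy scaler0 addr0.
Qed.
HB.instance Definition _ := GRing.isSubmodClosed.Build A M lker_pred lker_submod.
Record lker_type := LKer { lker_val :> M; _ : lker_val \in lker_pred }.
HB.instance Definition _ := [isSub for lker_val].
HB.instance Definition _ := [Choice of lker_type by <:].
HB.instance Definition _ := [SubChoice_isSubLmodule of lker_type by <:].
End Kernel.

Fixpoint syzygy (M : lmodType A) n : lmodType A :=
  if n is n'.+1 then lker_type (fglift (@id (syzygy M n'))) else M.

Lemma projective_resolution_exists (M : lmodType A) :
  inhabited (projective_resolution M).
Proof.
pose P n : lmodType A := {freeg (syzygy M n) / A}.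
pose e n : {linear P n -> syzygy M n} := fglift (@id (syzygy M n)).
pose d n : {linear P n.+1 -> P n} :=
  (val : lker_type (fglift (@id (syzygy M n))) -> P n) \o e n.+1.
have es n (y : syzygy M n) : exists x, e n x = y.
  by exists << y >>; rewrite /e /= liftU scale1r.
have ex n x : e n x = 0 <-> exists y, d n y = x.
  split=> [ex0|[y <-]].
    have xk : x \in lker_pred (fglift (@id (syzygy M n))).
      by rewrite inE; apply/eqP.
    have [y yx] := es n.+1 (LKer xk).
    by exists y; rewrite /d /= -[fglift _ _]/(e n.+1 y) yx.
  by apply/eqP; exact: (valP (e n.+1 y)).
split; apply: (@ProjectiveResolution A M P d (e 0%N)).
- by move=> n; exact: free_projective.
- exact: (es 0%N).
- exact: (ex 0%N).
- move=> n x; rewrite -ex; split=> [dx|ex0]; first exact: val_inj.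
  by rewrite -[d n x]/(val (e n.+1 x)) ex0.
Qed.
End FreeResolution.

(* M viewed as a k-space through the structure map k -> A. *)
Definition restrict_scalars (k : fieldType) (A : algType k)
  (M : lmodType A) : Type := M.

Section RestrictScalars.
Variables (k : fieldType) (A : algType k) (M : lmodType A).
Local Notation W := (restrict_scalars M).

HB.instance Definition _ := GRing.Zmodule.copy W M.

Definition restrict_scale (c : k) (x : W) : W := (c%:A : A) *: (x : M).

Fact restrict_scaleA a b x :
  restrict_scale a (restrict_scale b x) = restrict_scale (a * b) x.
Proof. by rewrite /restrict_scale scalerA -scalerAl mul1r scalerA. Qed.

Fact restrict_scale1 : left_id 1 restrict_scale.
Proof. by move=> x; rewrite /restrict_scale !scale1r. Qed.

Fact restrict_scaleDr : right_distributive restrict_scale +%R.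
Proof. by move=> a x y; rewrite /restrict_scale scalerDr. Qed.

Fact restrict_scaleDl x : {morph restrict_scale^~ x : a b / a + b}.
Proof. by move=> a b; rewrite /restrict_scale !scalerDl. Qed.

HB.instance Definition _ := GRing.Zmodule_isLmodule.Build k W
  restrict_scaleA restrict_scale1 restrict_scaleDr restrict_scaleDl.

End RestrictScalars.

Section Quivers.
Variables (k : fieldType) (A : algType k).

(* Hom_A(M, N), inside the k-space of all functions M -> N. *)
Definition hom_space (M N : lmodType A) : set (M -> restrict_scalars N) :=
  [set f | exists g : {linear M -> N}, f = (g : M -> N)].
Arguments hom_space M N _ : clear implicits.

Definition splitting (s : nat) (S : 'I_s -> lmodType A) : Prop :=
  forall i, dim_quotient (hom_space (S i) (S i)) [set 0] 1%N.

Definition ext1_cocycles (M N : lmodType A) (P : projective_resolution M) :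
    set (res_obj P 1%N -> restrict_scalars N) :=
  [set f | hom_space (res_obj P 1%N) N f /\ forall x, f (res_diff P 1%N x) = 0].
Arguments ext1_cocycles {M} N P _.

Definition ext1_coboundaries (M N : lmodType A) (P : projective_resolution M) :
    set (res_obj P 1%N -> restrict_scalars N) :=
  [set f | exists2 g : res_obj P 0%N -> restrict_scalars N,
     hom_space (res_obj P 0%N) N g & f = g \o res_diff P 0%N].
Arguments ext1_coboundaries {M} N P _.

(* dim_k Ext^1_A(M, N) = m.  Ext^1 does not depend, up to isomorphism, on the
   resolution from which it is computed: all of them are required to give m,
   and there is one by [projective_resolution_exists]. *)
Definition ext1_dim (M N : lmodType A) (m : nat) : Prop :=
  forall P : projective_resolution M,
    dim_quotient (ext1_cocycles N P) (ext1_coboundaries N P) m.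

Definition ext_quiver_arrows (s : nat) (S : 'I_s -> lmodType A)
    (i j : 'I_s) (m : nat) : Prop :=
  ext1_dim (S i) (S j) m.

Local Notation r := (@jacobson_radical A).
Local Notation r2 := (ideal_mul r r).

(* [pi : A -> B] identifies B with the quotient algebra A / r. *)
Definition radical_quotient (B : algType k) (pi : {lrmorphism A -> B}) : Prop :=
  (forall y, exists x, pi x = y) /\ (forall x, pi x = 0 <-> r x).

Definition matrix_block (B : algType k) (I : set B) (n : nat) : Prop :=
  exists phi : {linear 'M[k]_n -> B},
    [/\ injective phi, range phi = I &
        forall X Y, phi (X *m Y) = phi X * phi Y].

Section NaturalQuiver.
Variables (B : algType k) (pi : {lrmorphism A -> B}).
Variables (s : nat) (blk : 'I_s -> set B).

(* S i is a module over the block A_i: every other block annihilates it. *)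
Definition modules_of_blocks (S : 'I_s -> lmodType A) : Prop :=
  forall i l, l != i -> forall (a : A) (x : S i), blk l (pi a) -> a *: x = 0.

(* Subgroups of r / r^2 are represented by their preimages in r, i.e. by the
   subgroups of r containing r^2; A / r acts on r / r^2 through lifts to A. *)

(* The A_j-A_i-bimodule A_j (r / r^2) A_i. *)
Definition arrow_bimodule (i j : 'I_s) : set A :=
  smallest (@add_subgroup A)
    (r2 `|` [set x | exists a y b,
       [/\ blk j (pi a), r y, blk i (pi b) & x = a * y * b]]).

Definition sub_bimodule (i j : 'I_s) (N : set A) : Prop :=
  [/\ add_subgroup N, r2 `<=` N, N `<=` arrow_bimodule i j,
      forall a x, blk j (pi a) -> N x -> N (a * x) &
      forall x b, blk i (pi b) -> N x -> N (x * b)].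

Definition generates_arrow_bimodule (i j : 'I_s) (t : nat)
    (x : 'I_t -> A) : Prop :=
  (forall l, arrow_bimodule i j (x l)) /\
  smallest (sub_bimodule i j) (range x) = arrow_bimodule i j.

Definition natural_quiver_arrows (i j : 'I_s) (t : nat) : Prop :=
  (exists x : 'I_t -> A, generates_arrow_bimodule i j x) /\
  (forall u (x : 'I_u -> A), generates_arrow_bimodule i j x -> (t <= u)%N).

End NaturalQuiver.
End Quivers.

(* Main.v *)
(* Let e_i, e_j be lifts to A of rank one idempotents of the blocks A_i, A_j and
   V = e_j (r/r^2) e_i, a finite-dimensional space since A is Artinian; put
   m = dim V.

   Ext: S_i = A/L with L = {a | a x0 = 0} for some x0 in e_i S_i, and
   Ext^1(S_i, S_j) is the space of maps L -> S_j modulo restrictions of maps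
   A -> S_j.  As a = a (1 - e_i) + a e_i with 1 - e_i in L and a e_i in r for a
   in L, restricting to r identifies it with the maps g : r -> S_j such that
   g (x e_i) = g x; these kill r^2, and being determined by their values on
   e_j r e_i, where they land in the line e_j S_j, they form the dual of V.
   This needs no lifting of idempotents: e_i and e_j are idempotent modulo r only.

   Natural quiver: A_j (r/r^2) A_i = k^(n_j) (x) V (x) k^(n_i)^*, whose
   sub-bimodules correspond to subspaces of V.  An element has n_i n_j entries
   in V, so t elements can generate iff t n_i n_j vectors can span V. *)
Require Import Defs.
From HB Require Import structures.
From mathcomp Require Import all_boot all_order all_algebra.
From mathcomp Require Import boolp classical_sets functions.

Set Implicit Arguments.
Unset Strict Implicit.
Unset Printing Implicit Defensive.

Import Order.TTheory GRing.Theory Num.Theory.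

Local Open Scope classical_set_scope.
Local Open Scope ring_scope.

(** * Subspaces and dimensions of quotients *)

Section Subspaces.
Variables (k : fieldType) (V : lmodType k).

Definition subspace (U : set V) : Prop :=
  U 0 /\ forall c x y, U x -> U y -> U (c *: x + y).

Variable U : set V.
Hypothesis Usub : subspace U.

Lemma subspaceZ c x : U x -> U (c *: x).
Proof. by move=> Ux; rewrite -[_ *: _]addr0; apply: Usub.2 => //; apply: Usub.1. Qed.

Lemma subspaceD x y : U x -> U y -> U (x + y).
Proof. by move=> Ux Uy; rewrite -[x]scale1r; apply: Usub.2. Qed.

Lemma subspaceN x : U x -> U (- x).
Proof. by move=> Ux; rewrite -scaleN1r; apply: subspaceZ. Qed.

Lemma subspaceB x y : U x -> U y -> U (x - y).
Proof. by move=> Ux Uy; apply: subspaceD => //; apply: subspaceN. Qed.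

Lemma subspace_sum (I : Type) (s : seq I) (P : pred I) (F : I -> V) :
  (forall l, P l -> U (F l)) -> U (\sum_(l <- s | P l) F l).
Proof. by move=> UF; apply: big_ind => //; [apply: Usub.1 | apply: subspaceD]. Qed.

End Subspaces.

(** Preimages in [Z] of the unit vectors form the basis: subtracting the combination with
    coefficients [g] from [v] changes [c v] to [c v - g], so [c v] is the only admissible
    coefficient vector. *)
Lemma dim_quotient_linear (k : fieldType) (V : lmodType k) (Z B : set V)
    (m : nat) (c : {linear V -> 'rV[k]_m}) :
    subspace Z -> (forall f, Z f -> (B f <-> c f = 0)) ->
    (forall g, exists2 f, Z f & c f = g) ->
  dim_quotient Z B m.
Proof.
move=> Zsub ZB csurj.
have bP (l : 'I_m) : {f | Z f & c f = delta_mx 0 l} by apply: cid2; apply: csurj.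
pose b l := s2val (bP l); have Zb l : Z (b l) := s2valP (bP l).
have cb l : c (b l) = delta_mx 0 l := s2valP' (bP l).
exists b; split=> // v Zv.
have cE (g : 'rV[k]_m) : c (v - \sum_(l < m) g 0 l *: b l) = c v - g.
  rewrite linearB linear_sum; congr (_ - _); rewrite [RHS]row_sum_delta.
  by apply: eq_bigr => l _; rewrite linearZ /= cb.
have Zg (g : 'rV[k]_m) : Z (v - \sum_(l < m) g 0 l *: b l).
  by apply: subspaceB => //; apply: subspace_sum => // l _; apply: subspaceZ.
exists (c v); split; first by apply/ZB => //; rewrite cE subrr.
by move=> g /ZB => /(_ (Zg g)); rewrite cE => /subr0_eq.
Qed.

(** * Finite dimension from the descending chain condition *)

Section DescendingChain.
Variables (k : fieldType) (V : lmodType k) (Z B : set V).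
Hypotheses (Zsub : subspace Z) (Bsub : subspace B) (BZ : B `<=` Z).

Let comb (x : nat -> V) (c : nat -> k) n := \sum_(0 <= l < n) c l *: x l.

Let spanned x n v := exists c, B (v - comb x c n).

(** In a dependency modulo [B] the last coefficient must vanish, since dividing by it would express
    the last vector through the earlier ones; induction removes the others. *)
Lemma comb_independent (x : nat -> V) n :
    (forall l, (l < n)%N -> ~ spanned x l (x l)) ->
  forall c, B (comb x c n) -> forall l, (l < n)%N -> c l = 0.
Proof.
elim: n => // n IHn xP c; rewrite /comb big_nat_recr //= => Bc l.
have cn0 : c n = 0.
  apply/eqP/negP => /negP cn; apply: (xP n) => //.
  exists (fun l => - ((c n)^-1 * c l)).
  have -> : x n - comb x (fun l => - ((c n)^-1 * c l)) n
      = (c n)^-1 *: (\sum_(0 <= i < n) c i *: x i + c n *: x n).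
    rewrite scalerDr scalerA mulVf // scale1r addrC; congr (_ + _).
    rewrite /comb -sumrN scaler_sumr; apply: eq_bigr => i _.
    by rewrite scaleNr opprK scalerA.
  by apply: subspaceZ.
rewrite ltnS leq_eqVlt => /predU1P[-> //|]; apply: IHn => [p pn|].
  by apply: xP; apply: ltnW.
by move: Bc; rewrite cn0 scale0r addr0.
Qed.

(** Each term is chosen outside [B] plus the span of its predecessors whenever [Z] allows it, so a
    term lying in that span shows that nothing was left to choose. *)
Lemma greedy_sequence : exists x : nat -> V, (forall n, Z (x n)) /\
  forall n, spanned x n (x n) -> forall v, Z v -> spanned x n v.
Proof.
pose spans (s : seq V) v := exists c, B (v - comb (nth 0 s) c (size s)).
have fP s : {v | Z v /\ (spans s v -> forall w, Z w -> spans s w)}.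
  apply: cid; have [sZ|/existsNP[v /not_implyP[Zv sv]]] :=
    pselect (forall w, Z w -> spans s w).
    (* The predecessors already span [Z]; 0 is a filler. *)
    by exists 0; split=> //; apply: Zsub.1.
  by exists v; split.
pose f s := projT1 (fP s).
(* Each choice depends on all earlier ones, so the recursion builds the list of the first [n]
   choices. *)
pose L := fix L n := if n is n'.+1 then rcons (L n') (f (L n')) else [::].
have sizeL n : size (L n) = n by elim: n => //= n IH; rewrite size_rcons IH.
have nthL n l : (l < n)%N -> nth 0 (L n) l = f (L l).
  elim: n => //= n IH; rewrite ltnS leq_eqVlt nth_rcons sizeL => /predU1P[->|ln].
    by rewrite ltnn eqxx.
  by rewrite ln IH.
have spansE n : spans (L n) = spanned (fun n => f (L n)) n.
  apply/funext => v; apply/propext.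
  suff E c : comb (nth 0 (L n)) c (size (L n)) = comb (fun n => f (L n)) c n.
    by split=> -[c Bc]; exists c; rewrite ?E // -E.
  by rewrite /comb sizeL; apply: eq_big_nat => l /andP[_ ln]; rewrite nthL.
exists (fun n => f (L n)); split=> n; rewrite /f; case: (fP _) => v /= [Zv sv] //.
by rewrite -spansE; apply: sv.
Qed.

(** If the greedy sequence never became dependent, the spans of its tails would descend strictly.
    Hence it does, and the first index at which this happens is the dimension. *)
Lemma dcc_dim_quotient :
    (forall U : nat -> set V, (forall n, subspace (U n)) ->
      (forall n, U n.+1 `<=` U n) ->
      (forall n, B `<=` U n) -> (forall n, U n `<=` Z) ->
      exists n, U n `<=` U n.+1) ->
  exists m, dim_quotient Z B m.
Proof.
move=> dcc; have [x [Zx xP]] := greedy_sequence.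
have [allfree|/existsNP[n0]] := pselect (forall n, ~ spanned x n (x n)).
  (* [U n] is [B] plus the span of the [x l] with [l >= n]; [M] bounds the length of the
     combination. *)
  exfalso; pose U n := [set v | exists M c,
    (forall l, (l < n)%N -> c l = 0) /\ B (v - comb x c M)].
  (* Combinations of different lengths are padded with zeros before being added. *)
  have combP a M c M' c' : comb x (fun l => a * (if (l < M)%N then c l else 0) +
      (if (l < M')%N then c' l else 0)) (maxn M M') = a *: comb x c M + comb x c' M'.
    rewrite /comb scaler_sumr (big_nat_widen 0 M _ _ _ (leq_maxl M M')).
    rewrite (big_nat_widen 0 M' _ _ _ (leq_maxr M M')) !big_mkcondl.
    rewrite [X in X + _]big_mkcond [X in _ + X]big_mkcond -big_split /=.
    apply: eq_bigr => l _; rewrite scalerDl -scalerA.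
    by case: ifP => _; case: ifP => _; rewrite ?(scale0r, scaler0).
  case: (dcc U) => [n|n v [M [c [c0 Bc]]]|n v Bv|n v [M [c [c0 Bc]]]|n Un].
  - split=> [|a v w [M [c [c0 Bc]]] [M' [c' [c0' Bc']]]].
      exists 0%N, (fun=> 0); split=> //; rewrite /comb big_geq // subrr.
      exact: Bsub.1.
    exists (maxn M M'), (fun l => a * (if (l < M)%N then c l else 0) +
      (if (l < M')%N then c' l else 0)); split=> [l ln|].
      by rewrite c0 // c0' // !if_same mulr0 addr0.
    by rewrite combP opprD addrACA -scalerBr; apply: Bsub.2.
  - by exists M, c; split=> // l ln; apply: c0; apply: ltnW.
  - by exists 0%N, (fun=> 0); split=> //; rewrite /comb big_geq // subr0.
  - rewrite -[v](subrK (comb x c M)); apply: (subspaceD Zsub); first exact: BZ.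
    by apply: subspace_sum => // l _; apply: subspaceZ.
  have [|M [c [c0 Bc]]] := Un (x n).
    exists n.+1, (fun l => (l == n)%:R); split=> [l ln|]; first by rewrite ltn_eqF.
    rewrite /comb big_nat_recr //= eqxx scale1r big_nat big1 ?add0r ?subrr => [|l ln].
      exact: Bsub.1.
    by rewrite ltn_eqF ?scale0r.
  (* As [x n] lies in [U n.+1], subtracting it from a combination of later terms gives a dependency
     whose coefficient at [n] is -1. *)
  have := @comb_independent x (maxn n.+1 M) (fun l _ => allfree l)
    (fun l => (-1) * (if (l < n.+1)%N then (l == n)%:R else 0) +
              (if (l < M)%N then c l else 0)).
  rewrite combP => /(_ _ n) /=; rewrite ltnSn eqxx c0 // if_same addr0 => h.
  suff /h/(_ (leq_maxl _ _))/eqP :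
      B (-1 *: comb x (fun l => (l == n)%:R) n.+1 + comb x c M).
    by rewrite mulr1 oppr_eq0 oner_eq0.
  have -> : comb x (fun l => (l == n)%:R) n.+1 = x n.
    rewrite /comb big_nat_recr //= eqxx scale1r big_nat big1 ?add0r // => l ln.
    by rewrite ltn_eqF ?scale0r.
  by rewrite scaleN1r -[comb x c M]opprK -opprD; apply: subspaceN.
move=> /contrapT Sn0.
have ex : exists n, `[< spanned x n (x n) >] by exists n0; apply/asboolP.
(* Minimality of [m] makes the first [m] terms independent modulo [B]; [Sm] makes them span. *)
case: (ex_minnP ex) => m /asboolP Sm mmin.
exists m, (fun l => x l); split=> // v Zv.
have [c Bc] := xP m Sm v Zv.
have combE (g : 'rV[k]_m) (d : nat -> k) : (forall l : 'I_m, d l = g 0 l) ->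
    \sum_(l < m) g 0 l *: x l = comb x d m.
  by move=> dg; rewrite /comb big_mkord; apply: eq_bigr => l _; rewrite dg.
exists (\row_l c l); split; first by rewrite (combE _ c) // => l; rewrite mxE.
move=> g Bg; apply/rowP => l; rewrite mxE; apply/eqP; rewrite -subr_eq0; apply/eqP.
pose d p := c p - (if insub p is Some l then g 0 l else 0).
have dE (q : 'I_m) : d q = c q - g 0 q by rewrite /d valK.
rewrite -dE; apply: (@comb_independent x m) => // [p pm sp|].
  by have := mmin p (introT (asboolP _) sp); rewrite leqNgt pm.
rewrite -(combE (\row_l d l)) => [|q]; last by rewrite mxE.
have -> : \sum_(l < m) (\row_l d l) 0 l *: x l
   = (v - \sum_(l < m) g 0 l *: x l) - (v - comb x c m).
  rewrite opprB addrC addrA subrK /comb big_mkord -sumrB.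
  by apply: eq_bigr => q _; rewrite mxE dE scalerBl.
by apply: subspaceB.
Qed.

End DescendingChain.

(** * Calculation modulo the square of the radical *)

Lemma smallest_add_subgroup (V : zmodType) (G : set V) :
  add_subgroup (smallest (@add_subgroup V) G).
Proof.
split=> [N [[]] //|x y Gx Gy N NP]; have [NB _] := NP.
by apply: NB.2; [apply: Gx | apply: Gy].
Qed.

Lemma add_subgroupD (V : zmodType) (G : set V) x y :
  add_subgroup G -> G x -> G y -> G (x + y).
Proof.
by case=> G0 GB Gx Gy; rewrite -[y]opprK; apply: (GB) => //; rewrite -sub0r; apply: GB.
Qed.

Lemma add_subgroup_sum (V : zmodType) (G : set V) (I : Type) (s : seq I)
    (P : pred I) (F : I -> V) :
  add_subgroup G -> (forall l, P l -> G (F l)) -> G (\sum_(l <- s | P l) F l).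
Proof. by move=> GP GF; apply: big_ind => //; [apply: GP.1 | move=> *;
  apply: add_subgroupD]. Qed.

(** Equality in r/r^2, expressed on representatives so that no quotient has to be formed. *)
Definition eqr2 (R : nzRingType) (x y : R) : Prop :=
  ideal_mul (@jacobson_radical R) (@jacobson_radical R) (x - y).

Section RadicalQuotient.
Variables (k : fieldType) (A B : algType k) (pi : {lrmorphism A -> B}).
Hypothesis piP : radical_quotient pi.
Local Notation r := (@jacobson_radical A).
Local Notation r2 := (ideal_mul r r).

Implicit Types a b x y z : A.

Lemma rlift_exists (y : B) : exists x, pi x = y. Proof. exact: piP.1. Qed.

(** An arbitrary section of [pi], neither additive nor multiplicative: identities between lifts hold
    modulo r only, and are used through their action on r/r^2 or on irreducible modules. *)
Definition rlift (y : B) := projT1 (cid (rlift_exists y)).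

Lemma rliftK (y : B) : pi (rlift y) = y.
Proof. by rewrite /rlift; case: cid. Qed.

Lemma radE x : r x <-> pi x = 0. Proof. by split=> /piP.2. Qed.

Lemma radP x : pi x = 0 -> r x. Proof. by move/radE. Qed.

Lemma rad0 : r 0. Proof. by apply/radE; rewrite linear0. Qed.

Lemma radMl a x : r x -> r (a * x).
Proof. by move=> /radE rx; apply/radE; rewrite rmorphM /= rx mulr0. Qed.

Lemma radMr x b : r x -> r (x * b).
Proof. by move=> /radE rx; apply/radE; rewrite rmorphM /= rx mul0r. Qed.

Lemma rad_subspace : subspace r.
Proof.
split=> [|c x y /radE rx /radE ry]; first exact: rad0.
by apply/radE; rewrite linearP /= rx ry scaler0 addr0.
Qed.

Lemma rad_congr a b : pi a = pi b -> r (a - b).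
Proof. by move=> ab; apply/radE; rewrite linearB /= ab subrr. Qed.

Lemma rad2_add_subgroup : add_subgroup r2.
Proof. exact: smallest_add_subgroup. Qed.

Lemma rad2M x y : r x -> r y -> r2 (x * y).
Proof. by move=> rx ry; apply: sub_gen_smallest; exists x => //; exists y. Qed.

Lemma rad2_rad : r2 `<=` r.
Proof.
apply: smallest_sub => [|_ [a ra [b rb ->]]]; last exact: radMl.
by split=> [|x y]; [exact: rad0 | apply: subspaceB; exact: rad_subspace].
Qed.

Lemma rad2Ml a x : r2 x -> r2 (a * x).
Proof.
apply: (@smallest_sub _ _ _ [set x | r2 (a * x)]).
  split=> [|y z ay az] /=; first by rewrite mulr0; apply: rad2_add_subgroup.1.
  by rewrite mulrBr; apply: rad2_add_subgroup.2.
by move=> _ [y ry [z rz ->]] /=; rewrite mulrA; apply: rad2M => //; apply: radMl.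
Qed.

Lemma rad2Mr x b : r2 x -> r2 (x * b).
Proof.
apply: (@smallest_sub _ _ _ [set x | r2 (x * b)]).
  split=> [|y z ay az] /=; first by rewrite mul0r; apply: rad2_add_subgroup.1.
  by rewrite mulrBl; apply: rad2_add_subgroup.2.
by move=> _ [y ry [z rz ->]] /=; rewrite -mulrA; apply: rad2M => //; apply: radMr.
Qed.

Lemma rad2_subspace : subspace r2.
Proof.
split=> [|c x y rx ry]; first exact: rad2_add_subgroup.1.
apply: (add_subgroupD rad2_add_subgroup) => //.
by rewrite -[x]mul1r scalerAl; apply: rad2Ml.
Qed.

Lemma eqr2_refl x : eqr2 x x.
Proof. by rewrite /eqr2 subrr; apply: rad2_add_subgroup.1. Qed.

Lemma eqr2_sym x y : eqr2 x y -> eqr2 y x.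
Proof. by move=> xy; rewrite /eqr2 -opprB; apply: (subspaceN rad2_subspace). Qed.

Lemma eqr2_trans y x z : eqr2 x y -> eqr2 y z -> eqr2 x z.
Proof.
move=> xy yz; rewrite /eqr2 -[x](subrK y) -addrA.
by apply: (subspaceD rad2_subspace).
Qed.

Lemma eqr2Ml a x y : eqr2 x y -> eqr2 (a * x) (a * y).
Proof. by move=> xy; rewrite /eqr2 -mulrBr; apply: rad2Ml. Qed.

Lemma eqr2Mr b x y : eqr2 x y -> eqr2 (x * b) (y * b).
Proof. by move=> xy; rewrite /eqr2 -mulrBl; apply: rad2Mr. Qed.

Lemma eqr2_sum (I : Type) (s : seq I) (P : pred I) (F G : I -> A) :
  (forall l, P l -> eqr2 (F l) (G l)) ->
  eqr2 (\sum_(l <- s | P l) F l) (\sum_(l <- s | P l) G l).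
Proof.
by move=> FG; rewrite /eqr2 -sumrB; apply: (subspace_sum rad2_subspace).
Qed.

(** This is the action of A/r on r/r^2: the difference [a - b] lies in r, so its product with [x]
    lies in r^2. *)
Lemma eqr2_actl a b x : pi a = pi b -> r x -> eqr2 (a * x) (b * x).
Proof. by move=> ab rx; rewrite /eqr2 -mulrBl; apply: rad2M => //; apply: rad_congr. Qed.

Lemma eqr2_actr a b x : pi a = pi b -> r x -> eqr2 (x * a) (x * b).
Proof. by move=> ab rx; rewrite /eqr2 -mulrBr; apply: rad2M => //; apply: rad_congr. Qed.

End RadicalQuotient.

(** * Matrix units in a block *)

Section MatrixBlock.
Variables (k : fieldType) (B : algType k) (n : nat) (phi : {linear 'M[k]_n -> B}).
Hypotheses (phiM : forall X Y, phi (X *m Y) = phi X * phi Y)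
  (phi_ideal : two_sided_ideal (range phi)).

(** The matrix [X] is the component of [b] in the block. With u the image of the identity matrix, u
    b and b u lie in the ideal, where u is a unit, so both equal u b u; hence one [X] serves on both
    sides. *)
Lemma block_coef b :
  exists X, forall Y, phi Y * b = phi (Y *m X) /\ b * phi Y = phi (X *m Y).
Proof.
have [[_ Il] Ir] := phi_ideal.
have [X _ XE] : range phi (phi 1%:M * b) by apply: Ir; exists 1%:M.
have [X' _ X'E] : range phi (b * phi 1%:M) by apply: Il; exists 1%:M.
have XX' : phi X = phi X'.
  by rewrite -[X]mulmx1 phiM XE -mulrA -X'E -phiM mul1mx.
exists X => Y; split; first by rewrite -[Y in LHS]mulmx1 phiM -mulrA -XE -phiM.
by rewrite -[Y in LHS]mul1mx phiM mulrA -X'E -XX' -phiM.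
Qed.

Lemma delta_mx_sandwich (o : 'I_n) (X : 'M[k]_n) a b :
  delta_mx o a *m X *m delta_mx b o = X a b *: delta_mx o o.
Proof.
apply/matrixP => p q; rewrite !mxE (bigD1 b) //= big1 ?addr0 => [|c cb]; last first.
  by rewrite [X in _ * X]mxE (negPf cb) /= mulr0.
rewrite !mxE eqxx /= (bigD1 a) //= big1 ?addr0 => [|c ca]; last first.
  by rewrite !mxE (negPf ca) andbF /= mul0r.
rewrite !mxE eqxx andbT.
by case: (p == o); case: (q == o); rewrite !(mul1r, mul0r, mulr1, mulr0).
Qed.

Lemma delta_mx_mull (o a : 'I_n) (X : 'M[k]_n) :
  delta_mx o a *m X = \sum_c X a c *: delta_mx o c.
Proof.
apply/matrixP => p q; rewrite !mxE summxE (bigD1 a) //= big1 ?addr0 => [|c ca]; last first.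
  by rewrite !mxE (negPf ca) andbF /= mul0r.
rewrite (bigD1 q) //= big1 ?addr0 => [|c ca]; last first.
  by rewrite !mxE [q == c]eq_sym (negPf ca) andbF /= mulr0.
by rewrite !mxE !eqxx !andbT mulrC.
Qed.

Lemma delta_mx_mulr (o a : 'I_n) (X : 'M[k]_n) :
  X *m delta_mx a o = \sum_c X c a *: delta_mx c o.
Proof.
apply/matrixP => p q; rewrite !mxE summxE (bigD1 a) //= big1 ?addr0 => [|c ca]; last first.
  by rewrite !mxE (negPf ca) /= mulr0.
rewrite (bigD1 p) //= big1 ?addr0 => [|c ca]; last first.
  by rewrite !mxE [p == c]eq_sym (negPf ca) /= mulr0.
by rewrite !mxE !eqxx.
Qed.

Lemma mx1_sum_delta : (1%:M : 'M[k]_n) = \sum_a delta_mx a a.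
Proof.
apply/matrixP => p q; rewrite summxE (bigD1 p) //= big1 => [|c cp].
  by rewrite !mxE eqxx addr0 eq_sym.
by rewrite !mxE [p == c]eq_sym (negPf cp).
Qed.

End MatrixBlock.

(** * Irreducible modules and the radical *)

Section IrreducibleModule.
Variables (R : nzRingType) (M : lmodType R).
Hypothesis Mirr : irreducible_module M.

Lemma irreducible_neq0 : exists w : M, w <> 0.
Proof.
apply: contrapT => /forallNP M0; apply: Mirr.1; apply/seteqP; split=> // w _.
exact: contrapT (M0 w).
Qed.

(** The set I w is a submodule, hence zero or everything. *)
Lemma irreducible_cyclic (I : set R) (w : M) : left_ideal I ->
  (forall a, I a -> a *: w = 0) \/ (forall v, exists2 a, I a & v = a *: w).
Proof.
move=> [[I0 IB] Il].
have [|Iw|Iw] := Mirr.2 [set v | exists2 a, I a & v = a *: w].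
- split=> [|b _ [a Ia ->]]; last by exists (b * a); rewrite ?scalerA //; apply: Il.
  split=> [|_ _ [a Ia ->] [b Ib ->]]; first by exists 0; rewrite ?scale0r.
  by exists (a - b); rewrite ?scalerBl //; apply: IB.
- by left=> a Ia; have : [set 0] (a *: w) by rewrite -Iw; exists a.
- by right=> v; have : [set: M] v by []; rewrite -Iw.
Qed.

Lemma irreducible_generator (w v : M) : w <> 0 -> exists a, v = a *: w.
Proof.
move=> w0; have [|w0'|/(_ v)[a _ ->]] := @irreducible_cyclic setT w; last by exists a.
  by split; first split.
by have := w0' 1 I; rewrite scale1r.
Qed.

(** The annihilator of a nonzero [w] is a maximal left ideal: a left ideal [J] containing it with J
    w nonzero has some [c] with c w = w, so it contains both 1 - c and c. *)
Lemma irreducible_rad a (w : M) : @jacobson_radical R a -> a *: w = 0.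
Proof.
have [->|w0] := pselect (w = 0); first by rewrite scaler0.
suff Im : maximal_left_ideal [set x : R | x *: w = 0] by move=> /(_ _ Im).
split.
- split=> [|b x]; last by rewrite /= -scalerA => ->; rewrite scaler0.
  by split=> [|x y] /=; [rewrite scale0r | rewrite scalerBl => -> ->; rewrite subrr].
- by move=> wT; have : [set: R] 1 by []; rewrite -wT /= scale1r.
move=> J Jl wJ; have [Jw|Jw] := irreducible_cyclic w Jl.
  by left; apply/seteqP; split.
right; apply/seteqP; split=> // b _.
have [c Jc wc] := Jw w; have [[J0 JB] JM] := Jl.
have J1 : J 1.
  rewrite -(subrK c 1) -[X in _ + X]opprK; apply: (JB) => //; last by rewrite -sub0r;
    apply: JB.
  by apply: wJ => /=; rewrite scalerBl scale1r -wc subrr.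
by rewrite -[b]mulr1; apply: JM.
Qed.

End IrreducibleModule.

(** * Irreducible modules over a matrix block *)

Section BlockModule.
Variables (k : fieldType) (A B : algType k) (pi : {lrmorphism A -> B}).
Hypothesis piP : radical_quotient pi.
Variables (n : nat) (phi : {linear 'M[k]_n -> B}).
Hypotheses (phiM : forall X Y, phi (X *m Y) = phi X * phi Y)
  (phi_ideal : two_sided_ideal (range phi)).
Variable o : 'I_n.
Local Notation E X := (rlift piP (phi X)).
Local Notation e := (E (delta_mx o o)).
Variable M : lmodType A.
Hypotheses (Mirr : irreducible_module M) (M1 : forall w : M, E 1%:M *: w = w).

Lemma irreducible_act a b (w : M) : pi a = pi b -> a *: w = b *: w.
Proof.
by move=> /(rad_congr piP)/(irreducible_rad Mirr w)/eqP; rewrite scalerBl subr_eq0 => /eqP.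
Qed.

(** The subspace e M is a line. It is nonzero because the identity is the sum of the products E_ao
    E_oa, and if s = e s generates M then e b s = e b e s is a multiple of s. *)
Lemma corner_vector : exists s : M,
  [/\ s <> 0, e *: s = s & forall w, exists c : k, e *: w = c%:A *: s].
Proof.
have [w w0] := irreducible_neq0 Mirr.
have [a aw] : exists a, E (delta_mx o a) *: w <> 0.
  apply: contrapT => /forallNP aw; apply: w0.
  rewrite -(M1 w) (@irreducible_act _ (\sum_a E (delta_mx a o) * E (delta_mx o a))).
    rewrite scaler_suml big1 // => a _.
    by rewrite -scalerA (contrapT (aw a)) scaler0.
  rewrite rliftK mx1_sum_delta !linear_sum; apply: eq_bigr => a _.
  by rewrite rmorphM /= !rliftK -phiM mul_delta_mx.
pose s := E (delta_mx o a) *: w.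
have es : e *: s = s.
  by rewrite scalerA; apply: irreducible_act; rewrite rmorphM /= !rliftK -phiM mul_delta_mx.
move: {aw}s es (aw : s <> 0) => s es s0.
exists s; split=> // v; have [b ->] := irreducible_generator Mirr v s0.
have [X XP] := block_coef phiM phi_ideal (pi b).
exists (X o o); rewrite -[in LHS]es -[in RHS]es !scalerA.
apply: irreducible_act; rewrite mulr_algl linearZ /= !rmorphM /= !rliftK.
by rewrite (XP _).1 -phiM delta_mx_sandwich linearZ.
Qed.

(** Let X be the component of [a] in the block. Then E_po and its transpose give E_op a e s = X_po
    s, which is zero, so column [o] of X vanishes; that column is the image of a e in A/r. *)
Lemma corner_annihilator (s : M) a :
  s <> 0 -> e *: s = s -> a *: s = 0 -> @jacobson_radical A (a * e).
Proof.
move=> s0 es as0; apply: (radP piP); rewrite rmorphM /= rliftK.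
have [X XP] := block_coef phiM phi_ideal (pi a).
rewrite (XP _).2 delta_mx_mulr big1 ?linear0 // => p _.
suff -> : X p o = 0 by rewrite scale0r.
apply/eqP/negP => /negP Xp; apply: s0.
have : (X p o)%:A *: s = 0.
  rewrite -[s in LHS]es scalerA (@irreducible_act _ (E (delta_mx o p) * a * e)).
    by rewrite -!scalerA es as0 scaler0.
  rewrite mulr_algl linearZ /= !rmorphM /= !rliftK -mulrA (XP _).2 -phiM.
  by rewrite mulmxA delta_mx_sandwich linearZ.
move/(congr1 (fun w => (X p o)^-1%:A *: w)); rewrite scaler0 scalerA.
by rewrite mulr_algl scalerA mulVf // scale1r scale1r.
Qed.

End BlockModule.

(** * The corner e_j (r/r^2) e_i and its coordinates *)

Section Corner.
Variables (k : fieldType) (A B : algType k) (pi : {lrmorphism A -> B}).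
Hypothesis piP : radical_quotient pi.
Variables (ni nj : nat).
Variables (phi_i : {linear 'M[k]_ni -> B}) (phi_j : {linear 'M[k]_nj -> B}).
Hypotheses (phi_iM : forall X Y, phi_i (X *m Y) = phi_i X * phi_i Y)
  (phi_jM : forall X Y, phi_j (X *m Y) = phi_j X * phi_j Y)
  (phi_i_ideal : two_sided_ideal (range phi_i))
  (phi_j_ideal : two_sided_ideal (range phi_j)).
Implicit Types x y z : A.
Variables (oi : 'I_ni) (oj : 'I_nj).
Local Notation r := (@jacobson_radical A).
Local Notation r2 := (ideal_mul r r).
Local Notation "x === y" := (eqr2 x y) (at level 70, no associativity).
Local Notation Ei X := (rlift piP (phi_i X)).
Local Notation Ej X := (rlift piP (phi_j X)).
Local Notation ei := (Ei (delta_mx oi oi)).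
Local Notation ej := (Ej (delta_mx oj oj)).

(** The preimage in r of V = e_j (r/r^2) e_i; a congruence is used because the lifts are idempotent
    modulo r only. *)
Definition corner : set A := [set x | r x /\ x === ej * x * ei].

Lemma eqr2Z c x y : x === y -> c *: x === c *: y.
Proof. by move=> xy; rewrite /eqr2 -scalerBr; apply: (subspaceZ (rad2_subspace piP)). Qed.

(** The scalar is the diagonal entry at [oj] of the component of [a] in A_j. *)
Lemma corner_scalar a : exists c, forall x, r x -> ej * a * ej * x === c *: (ej * x).
Proof.
have [X XP] := block_coef phi_jM phi_j_ideal (pi a).
exists (X oj oj) => x rx; rewrite scalerAl.
apply: (eqr2_actl piP) => //; rewrite linearZ /= !rmorphM /= !rliftK.
by rewrite (XP _).1 -phi_jM delta_mx_sandwich linearZ.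
Qed.

Lemma delta_mx_idem (n : nat) (o : 'I_n) :
  delta_mx o o *m delta_mx o o = delta_mx o o :> 'M[k]_n.
Proof. by rewrite mul_delta_mx. Qed.

Lemma corner_mul x : r x -> corner (ej * x * ei).
Proof.
move=> rx; split; first by apply: (radMr piP); apply: (radMl piP).
apply: (@eqr2_trans _ _ _ _ piP (ej * x * (ei * ei))).
  rewrite -!mulrA; apply: (eqr2Ml piP); apply: (eqr2_actr piP) => //.
  by rewrite rmorphM /= !rliftK -phi_iM delta_mx_idem.
rewrite !mulrA; do 2 apply: (eqr2Mr piP); apply: (eqr2_actl piP) => //.
by rewrite rmorphM /= !rliftK -phi_jM delta_mx_idem.
Qed.

Lemma corner_l x : corner x -> x === ej * x.
Proof.
move=> [rx xE]; apply: (eqr2_trans piP xE); apply: (eqr2_sym piP).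
apply: (eqr2_trans piP (eqr2Ml piP _ xE)); rewrite !mulrA; apply: (eqr2Mr piP).
apply: (eqr2_actl piP) => //.
by rewrite rmorphM /= !rliftK -phi_jM delta_mx_idem.
Qed.

Lemma corner_subspace : subspace corner.
Proof.
split=> [|c x y [rx xE] [ry yE]].
  by split; [exact: (rad0 piP) | rewrite mulr0 mul0r; apply: eqr2_refl].
split; first exact: (rad_subspace piP).2.
rewrite mulrDr mulrDl -scalerAr -scalerAl /eqr2 opprD addrACA -scalerBr.
exact: (rad2_subspace piP).2.
Qed.

Lemma rad2_corner : r2 `<=` corner.
Proof.
move=> x rx; split; first exact: (rad2_rad piP).
by apply: (subspaceB (rad2_subspace piP)) => //; apply: (rad2Mr piP); apply: (rad2Ml piP).
Qed.

(* A chain of subspaces U of e_j (r/r^2) e_i is recovered from the chain of the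
   left ideals {x in r | e_j A x in U}, since e_j A e_j is k e_j modulo r. *)
Lemma corner_dim : left_artinian A -> exists m, dim_quotient corner r2 m.
Proof.
move=> artA; apply: dcc_dim_quotient => //.
- exact: corner_subspace.
- exact: (rad2_subspace piP).
- exact: rad2_corner.
move=> U Usub Udec r2U UZ.
have Ucongr n x y : x === y -> U n y -> U n x.
  move=> /r2U xy Uy; rewrite -[x](subrK y).
  exact: (subspaceD (Usub n)).
pose I n := [set x | r x /\ forall a, U n (ej * a * x)].
have [n|n x [rx Ux]|N IN] := artA I.
- split; first split=> [|x y [rx Ux] [ry Uy]].
  + split; first exact: (rad0 piP).
    by move=> a; rewrite mulr0; exact: (Usub n).1.
  + split; first exact: (subspaceB (rad_subspace piP)).
    by move=> a; rewrite mulrBr; apply: (subspaceB (Usub n)).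
  + move=> a x [rx Ux]; split; first exact: (radMl piP).
    by move=> b; rewrite mulrA -[X in X * x]mulrA.
- by split=> // a; apply: Udec.
exists N => u Uu; have cu := UZ _ _ Uu; have [ru _] := cu.
have : I N u.
  split=> // a; have [c cP] := corner_scalar a.
  apply: (Ucongr _ _ (c *: u)); last exact: (subspaceZ (Usub N)).
  apply: (eqr2_trans piP (eqr2Ml piP _ (corner_l cu))).
  rewrite mulrA; apply: (eqr2_trans piP (cP _ ru)).
  by apply: eqr2Z; apply: (eqr2_sym piP); apply: corner_l.
rewrite -(IN N.+1) // => -[_ /(_ 1)]; rewrite mulr1.
by apply: Ucongr; apply: corner_l.
Qed.

(** The [y l] represent a basis of V, and [K x] holds the coordinates of e_j x e_i in it. [K] is
    total on A, but its values are meaningful only on r. *)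
Definition corner_coordinates (m : nat) (y : 'I_m -> A) (K : A -> 'rV[k]_m) :=
  [/\ forall l, corner (y l) /\ K (y l) = delta_mx 0 l,
      forall c x x', r x -> r x' -> K (c *: x + x') = c *: K x + K x',
      forall x, r2 x -> K x = 0 &
      forall x, r x -> ej * x * ei === \sum_l K x 0 l *: y l].

Lemma corner_coordinates_exist : left_artinian A ->
  exists m (y : 'I_m -> A) (K : A -> 'rV[k]_m), corner_coordinates y K.
Proof.
move=> /corner_dim[m [y [yc yP]]]; exists m, y.
(* Membership in r is a premise inside the existential, so that choice yields a total function. *)
have KP x : exists c : 'rV[k]_m, r x -> ej * x * ei === \sum_l c 0 l *: y l.
  have [rx|] := pselect (r x); last by exists 0.
  by have [c [cP _]] := yP _ (corner_mul rx); exists c.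
pose K x := projT1 (cid (KP x)).
have KE x : r x -> ej * x * ei === \sum_l K x 0 l *: y l.
  by rewrite /K; case: cid.
have Kuniq x (c : 'rV[k]_m) : r x -> ej * x * ei === \sum_l c 0 l *: y l -> K x = c.
  move=> rx xc; have [d [_ dP]] := yP _ (corner_mul rx).
  by rewrite -(dP c) // (dP (K x)) //; apply: KE.
exists K; split=> //.
- move=> l; split=> //; have [ry yE] := yc l; apply: Kuniq => //.
  apply: (eqr2_sym piP); rewrite (bigD1 l) //= mxE !eqxx scale1r big1 ?addr0 // => p pl.
  by rewrite mxE (negPf pl) andbF scale0r.
- move=> c x x' rx rx'; apply: Kuniq; first exact: (rad_subspace piP).2.
  rewrite mulrDr mulrDl -scalerAr -scalerAl.
  have -> : \sum_l (c *: K x + K x') 0 l *: y l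
      = c *: (\sum_l K x 0 l *: y l) + \sum_l K x' 0 l *: y l.
    rewrite scaler_sumr -big_split /=; apply: eq_bigr => l _.
    by rewrite !mxE scalerDl scalerA.
  by rewrite /eqr2 opprD addrACA -scalerBr; apply: (rad2_subspace piP).2; apply: KE.
- move=> x r2x; apply: Kuniq; first exact: (rad2_rad piP).
  rewrite big1 => [|l _]; last by rewrite mxE scale0r.
  by rewrite /eqr2 subr0; apply: (rad2Mr piP); apply: (rad2Ml piP).
Qed.

Section Coordinates.
Variables (m : nat) (y : 'I_m -> A) (K : A -> 'rV[k]_m).
Hypothesis KP : corner_coordinates y K.

Lemma coord_basis_corner l : corner (y l). Proof. by case: KP => /(_ l)[]. Qed.

Lemma coord_basis_rad l : r (y l). Proof. by have [] := coord_basis_corner l. Qed.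

Lemma coord_basis l : K (y l) = delta_mx 0 l. Proof. by case: KP => /(_ l)[]. Qed.

Lemma coordP c x x' : r x -> r x' -> K (c *: x + x') = c *: K x + K x'.
Proof. by case: KP => _ + _ _; apply. Qed.

Lemma coord_rad2 x : r2 x -> K x = 0. Proof. by case: KP => _ _ + _; apply. Qed.

Lemma coordE x : r x -> ej * x * ei === \sum_l K x 0 l *: y l.
Proof. by case: KP => _ _ _; apply. Qed.

Lemma coord_congr x x' : r x -> x' === x -> K x' = K x.
Proof.
move=> rx xx'; rewrite -[x'](subrK x) -[x' - x]scale1r coordP //;
  last exact: (rad2_rad piP).
by rewrite coord_rad2 // scaler0 add0r.
Qed.

Lemma coord_sum n (c : 'I_n -> k) (x : 'I_n -> A) :
  (forall l, r (x l)) -> K (\sum_l c l *: x l) = \sum_l c l *: K (x l).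
Proof.
move=> rx; elim: n c x rx => [|n IHn] c x rx.
  by rewrite !big_ord0 coord_rad2 //; exact: (rad2_subspace piP).1.
rewrite !big_ord_recl coordP ?IHn //.
by apply: (subspace_sum (rad_subspace piP)) => l _; apply: (subspaceZ (rad_subspace piP)).
Qed.

(** * Generators of the bimodule A_j (r/r^2) A_i *)

Section ArrowBimodule.
Variables (s : nat) (blk : 'I_s -> set B) (i j : 'I_s).
Hypotheses (blk_i : range phi_i = blk i) (blk_j : range phi_j = blk j).
Local Notation M := (arrow_bimodule pi blk i j).

Lemma arrow_add_subgroup : add_subgroup M.
Proof. exact: smallest_add_subgroup. Qed.

Lemma rad2_arrow : r2 `<=` M.
Proof. by move=> x rx; apply: sub_gen_smallest; left. Qed.

Lemma arrowM a x b : blk j (pi a) -> r x -> blk i (pi b) -> M (a * x * b).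
Proof. by move=> aj rx bi; apply: sub_gen_smallest; right; exists a, x, b. Qed.

Lemma arrow_rad : M `<=` r.
Proof.
apply: smallest_sub => [|x [/(rad2_rad piP) //|[a [z [b [_ rz _ ->]]]]]].
  by split=> [|x z]; [exact: (rad0 piP) | exact: (subspaceB (rad_subspace piP))].
by apply: (radMr piP); apply: (radMl piP).
Qed.

Lemma arrow_sub_bimodule : sub_bimodule pi blk i j M.
Proof.
split=> //; [exact: arrow_add_subgroup | exact: rad2_arrow | |].
- move=> a x aj.
  apply: (@smallest_sub _ _ _ [set x | M (a * x)]).
    split=> [|z t Mz Mt] /=; first by rewrite mulr0; apply: arrow_add_subgroup.1.
    by rewrite mulrBr; apply: arrow_add_subgroup.2.
  move=> z [rz|[a' [t [b [aj' rt bi ->]]]]] /=.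
    by apply: rad2_arrow; apply: (rad2Ml piP).
  rewrite !mulrA; apply: arrowM => //; rewrite rmorphM /= -blk_j.
  by apply: phi_j_ideal.2; rewrite blk_j.
- move=> x b bi.
  apply: (@smallest_sub _ _ _ [set x | M (x * b)]).
    split=> [|z t Mz Mt] /=; first by rewrite mul0r; apply: arrow_add_subgroup.1.
    by rewrite mulrBl; apply: arrow_add_subgroup.2.
  move=> z [rz|[a [t [b' [aj rt bi' ->]]]]] /=.
    by apply: rad2_arrow; apply: (rad2Mr piP).
  rewrite -mulrA; apply: arrowM => //; rewrite rmorphM /= -blk_i.
  by apply: phi_i_ideal.2; rewrite blk_i.
Qed.

Lemma sub_bimodule_congr N x x' : sub_bimodule pi blk i j N -> N x -> x' === x -> N x'.
Proof.
by move=> [Nadd r2N _ _ _] Nx /r2N xx'; rewrite -[x'](subrK x); apply: add_subgroupD.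
Qed.

Lemma coord_basis_arrow l : M (y l).
Proof.
apply: (sub_bimodule_congr arrow_sub_bimodule _ (coord_basis_corner l).2).
apply: arrowM; last 1 first.
- by rewrite rliftK -blk_i; eexists.
- by rewrite rliftK -blk_j; eexists.
- exact: coord_basis_rad.
Qed.

(** With fewer than [m] entries in all, some nonzero functional [g] on V kills every entry of every
    generator. The elements whose entries are killed by [g] form a sub-bimodule, which would then be
    everything, although [g] is nonzero. *)
Lemma generators_lower_bound u (x : 'I_u -> A) :
  generates_arrow_bimodule pi blk i j x -> (m <= u * (nj * ni))%N.
Proof.
move=> [xM xgen]; rewrite leqNgt; apply/negP => um.
(* The matrix entry of [z] at row [a] and column [b], transported into the corner. *)
pose entry a b z := Ej (delta_mx oj a) * z * Ei (delta_mx b oi).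
have entry_rad a b z : r z -> r (entry a b z).
  by move=> rz; apply: (radMr piP); apply: (radMl piP).
pose T : finType := ('I_u * ('I_nj * 'I_ni))%type.
have cardT : #|T| = (u * (nj * ni))%N by rewrite !card_prod !card_ord.
pose W := \matrix_(q < #|T|) K (entry (enum_val q).2.1 (enum_val q).2.2 (x (enum_val q).1)).
(* The transpose of [W] has [m] rows and fewer than [m] columns. *)
have : kermx W^T != 0.
  rewrite -mxrank_eq0 mxrank_ker subn_eq0 -ltnNge.
  by apply: leq_ltn_trans um; rewrite -cardT; apply: rank_leq_col.
case/rowV0Pn => g /sub_kermxP gW gn0.
have Wg p a b : K (entry a b (x p)) *m g^T = 0.
  move: (congr1 trmx gW);
    rewrite trmx_mul trmxK trmx0 => /(congr1 (row (enum_rank (p, (a, b)) : 'I_#|T|))).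
  by rewrite row_mul rowK enum_rankK row0.
pose N := [set z | M z /\ forall a b, K (entry a b z) *m g^T = 0].
have Nsub : sub_bimodule pi blk i j N.
  have [Madd _ _ Ml Mr] := arrow_sub_bimodule.
  split.
  - split=> [|z z' [Mz Nz] [Mz' Nz']].
      split=> [|a b]; first exact: Madd.1.
      rewrite /entry mulr0 mul0r coord_rad2 ?mul0mx //.
      exact: (rad2_subspace piP).1.
    split=> [|a b]; first exact: Madd.2.
    have -> : entry a b (z - z') = -1 *: entry a b z' + entry a b z.
      by rewrite /entry mulrBr mulrBl scaleN1r addrC.
    rewrite coordP; try by apply: entry_rad; apply: arrow_rad.
    by rewrite mulmxDl -scalemxAl Nz Nz' scaler0 addr0.
  - move=> z rz; split=> [|a b]; first exact: rad2_arrow.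
    rewrite coord_rad2 ?mul0mx //.
    by apply: (rad2Mr piP); apply: (rad2Ml piP).
  - by move=> z [].
  - move=> a z aj [Mz Nz]; split=> [|p q]; first exact: Ml.
    (* Left multiplication by [a] replaces the rows of entries by their combinations with
       coefficients from [X]. *)
    have [X _ Xa] : range phi_j (pi a) by rewrite blk_j.
    rewrite (@coord_congr (\sum_c X p c *: entry c q z)).
    + rewrite coord_sum => [|c]; last by apply: entry_rad; apply: arrow_rad.
      by rewrite mulmx_suml big1 // => c _; rewrite -scalemxAl Nz scaler0.
    + apply: (subspace_sum (rad_subspace piP)) => c _.
      apply: (subspaceZ (rad_subspace piP)); apply: entry_rad; exact: arrow_rad.
    have -> : \sum_c X p c *: entry c q z
        = (\sum_c X p c *: Ej (delta_mx oj c)) * z * Ei (delta_mx q oi).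
      by rewrite !mulr_suml; apply: eq_bigr => c _; rewrite !scalerAl.
    rewrite /entry mulrA; apply: (eqr2Mr piP); apply: (eqr2_actl piP);
      last exact: arrow_rad.
    rewrite rmorphM /= rliftK -Xa -phi_jM delta_mx_mull !linear_sum.
    by apply: eq_bigr => c _; rewrite !linearZ /= rliftK.
  - move=> z b bi [Mz Nz]; split=> [|p q]; first exact: Mr.
    have [X _ Xa] : range phi_i (pi b) by rewrite blk_i.
    rewrite (@coord_congr (\sum_c X c q *: entry p c z)).
    + rewrite coord_sum => [|c]; last by apply: entry_rad; apply: arrow_rad.
      by rewrite mulmx_suml big1 // => c _; rewrite -scalemxAl Nz scaler0.
    + apply: (subspace_sum (rad_subspace piP)) => c _.
      apply: (subspaceZ (rad_subspace piP)); apply: entry_rad; exact: arrow_rad.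
    have -> : \sum_c X c q *: entry p c z
        = Ej (delta_mx oj p) * z * (\sum_c X c q *: Ei (delta_mx c oi)).
      by rewrite !mulr_sumr; apply: eq_bigr => c _; rewrite scalerAr.
    rewrite /entry -!mulrA; apply: (eqr2Ml piP); apply: (eqr2_actr piP);
      last exact: arrow_rad.
    rewrite rmorphM /= rliftK -Xa -phi_iM delta_mx_mulr !linear_sum.
    by apply: eq_bigr => c _; rewrite !linearZ /= rliftK.
have MN : M `<=` N.
  by rewrite -xgen; apply: smallest_sub => // _ [p _ <-]; split.
(* Modulo r^2, [y l] is its own entry at ([oj], [oi]), so the coordinate of [g] at [l] vanishes. *)
case/negP: gn0; apply/eqP/rowP => l.
have [_ /(_ oj oi)] := MN _ (coord_basis_arrow l).
rewrite (@coord_congr (y l)); last by apply: (eqr2_sym piP);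
  apply: (coord_basis_corner l).2.
  by rewrite coord_basis -rowE => /rowP/(_ 0); rewrite !mxE.
exact: coord_basis_rad.
Qed.

(** A sub-bimodule is closed under sums and block multiplications; a scalar c acts on [y l] as the
    block element c e_j. *)
Lemma corner_in_sub_bimodule N : sub_bimodule pi blk i j N ->
  (forall l, N (y l)) -> forall z, r z -> N (ej * z * ei).
Proof.
move=> Nsub Ny z rz; have [Nadd _ _ Nl _] := Nsub.
apply: (sub_bimodule_congr Nsub _ (coordE rz)).
apply: add_subgroup_sum => // l _.
apply: (@sub_bimodule_congr _ ((K z 0 l *: ej) * y l)) => //.
  by apply: Nl => //; rewrite linearZ /= rliftK -linearZ -blk_j; eexists.
rewrite -scalerAl; apply: eqr2Z; apply: corner_l; exact: coord_basis_corner.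
Qed.

(** Inserting the sum of E_po e_j E_op between a and t, and likewise on the right with e_i, writes a
    t b modulo r^2 through the corner entries of t. *)
Lemma sub_bimodule_full N : sub_bimodule pi blk i j N ->
  (forall l, N (y l)) -> M `<=` N.
Proof.
move=> Nsub Ny; have [Nadd r2N _ Nl Nr] := Nsub.
apply: smallest_sub => // z [/r2N //|[a [t [b [aj rt bi ->]]]]].
have [X _ Xa] : range phi_j (pi a) by rewrite blk_j.
have [Y _ Yb] : range phi_i (pi b) by rewrite blk_i.
apply: (@sub_bimodule_congr _ (\sum_p \sum_q Ej (X *m delta_mx p oj) *
  (ej * (Ej (delta_mx oj p) * t * Ei (delta_mx q oi)) * ei) * Ei (delta_mx oi q *m Y))) => //.
  apply: add_subgroup_sum => // p _; apply: add_subgroup_sum => // q _.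
  apply: Nr; first by rewrite rliftK -blk_i; eexists.
  apply: Nl; first by rewrite rliftK -blk_j; eexists.
  apply: corner_in_sub_bimodule => //.
  by apply: (radMr piP); apply: (radMl piP).
have -> : \sum_p \sum_q Ej (X *m delta_mx p oj) *
    (ej * (Ej (delta_mx oj p) * t * Ei (delta_mx q oi)) * ei) * Ei (delta_mx oi q *m Y)
  = (\sum_p Ej (X *m delta_mx p oj) * (ej * Ej (delta_mx oj p))) * t *
    (\sum_q Ei (delta_mx q oi) * ei * Ei (delta_mx oi q *m Y)).
  rewrite !mulr_suml; apply: eq_bigr => p _; rewrite mulr_sumr.
  by apply: eq_bigr => q _; rewrite !mulrA.
apply: (@eqr2_trans _ _ _ _ piP
  (a * t * (\sum_q Ei (delta_mx q oi) * ei * Ei (delta_mx oi q *m Y)))).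
  rewrite -!mulrA; apply: (eqr2Ml piP); apply: (eqr2_actr piP) => //.
  rewrite linear_sum -Yb -[Y in LHS]mul1mx mx1_sum_delta mulmx_suml linear_sum.
  apply: eq_bigr => q _; rewrite !rmorphM /= !rliftK -!phi_iM.
  by rewrite mulmxA !mul_delta_mx.
apply: (eqr2Mr piP); apply: (eqr2_actl piP) => //.
rewrite linear_sum -Xa -[X in LHS]mulmx1 mx1_sum_delta mulmx_sumr linear_sum.
apply: eq_bigr => p _; rewrite !rmorphM /= !rliftK -!phi_jM.
by rewrite -mulmxA !mul_delta_mx.
Qed.

(** The basis vectors [y l] are distributed over the entries of [t] elements; multiplying by matrix
    units on both sides recovers each of them. *)
Lemma generators_exist t : (m <= t * (nj * ni))%N ->
  exists x : 'I_t -> A, generates_arrow_bimodule pi blk i j x.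
Proof.
move=> mt; pose T : finType := ('I_t * ('I_nj * 'I_ni))%type.
have cardT : #|T| = (t * (nj * ni))%N by rewrite !card_prod !card_ord.
(* Entries whose rank exceeds the last basis index are filled with 0. *)
pose Y (q : T) : A := if insub (enum_rank q : nat) is Some l then y l else 0.
have Yc q : corner (Y q).
  rewrite /Y; case: insub => [l|]; first exact: coord_basis_corner.
  exact: corner_subspace.1.
have Yr q : r (Y q) by have [] := Yc q.
have Ysurj l : exists q, Y q = y l.
  have lT : (l < #|T|)%N by rewrite cardT; apply: leq_trans mt.
  by exists (enum_val (Ordinal lT)); rewrite /Y enum_valK valK.
pose x p := \sum_a \sum_b Ej (delta_mx a oj) * Y (p, (a, b)) * Ei (delta_mx oi b).
exists x; have Mx p : M (x p).
  apply: add_subgroup_sum => [|a _]; first exact: arrow_add_subgroup.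
  apply: add_subgroup_sum => [|b _]; first exact: arrow_add_subgroup.
  by apply: arrowM => //; rewrite rliftK -(blk_i, blk_j); eexists.
split=> //; apply/seteqP; split.
  by apply: smallest_sub => [|_ [p _ <-] //]; apply: arrow_sub_bimodule.
move=> z Mz N [Nsub xN]; have [Nadd r2N _ Nl Nr] := Nsub.
apply: (sub_bimodule_full Nsub) Mz => l.
have [[p [a b]] <-] := Ysurj l.
apply: (@sub_bimodule_congr _ (Ej (delta_mx oj a) * x p * Ei (delta_mx b oi))) => //.
  apply: Nr; first by rewrite rliftK -blk_i; eexists.
  by apply: Nl; [rewrite rliftK -blk_j; eexists | apply: xN; exists p].
apply: (eqr2_sym piP).
have sandwich a' b' : Ej (delta_mx oj a) * (Ej (delta_mx a' oj) * Y (p, (a', b')) *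
    Ei (delta_mx oi b')) * Ei (delta_mx b oi) ===
    (if (a == a') && (b == b') then Y (p, (a', b')) else 0).
  apply: (@eqr2_trans _ _ _ _ piP (Ej (delta_mx oj oj *+ (a == a')) * Y (p, (a', b')) *
                         Ei (delta_mx oi oi *+ (b == b')))).
    apply: (@eqr2_trans _ _ _ _ piP (Ej (delta_mx oj a) * Ej (delta_mx a' oj) * Y (p, (a', b')) *
                         Ei (delta_mx oi oi *+ (b == b')))).
      rewrite -!mulrA; do 2 apply: (eqr2Ml piP); apply: (eqr2_actr piP) => //.
      by rewrite rmorphM /= !rliftK -phi_iM mul_delta_mx_cond [b' == b]eq_sym.
    apply: (eqr2Mr piP); apply: (eqr2_actl piP) => //.
    by rewrite rmorphM /= !rliftK -phi_jM mul_delta_mx_cond.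
  (* For distinct indices the lift of the zero matrix appears; it may be nonzero but lies in r, so
     its product with [Y] lies in r^2. *)
  case: eqP => [_|_] /=; last first.
    rewrite mulr0n /eqr2 subr0; apply: (rad2Mr piP).
    by apply: rad2M => //; apply: (radP piP); rewrite rliftK linear0.
  case: eqP => [_|_] /=; last first.
    rewrite mulr0n /eqr2 subr0; apply: rad2M.
      exact: (radMl piP).
    by apply: (radP piP); rewrite rliftK linear0.
  by rewrite !mulr1n; apply: (eqr2_sym piP); apply: (Yc _).2.
rewrite mulr_sumr mulr_suml.
have -> : Y (p, (a, b)) =
    \sum_a' \sum_b' (if (a == a') && (b == b') then Y (p, (a', b')) else 0).
  rewrite (bigD1 a) //= [X in _ + X]big1 ?addr0 => [|a' /negPf aa']; last first.
    by rewrite big1 // => b' _; rewrite eq_sym aa'.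
  rewrite (bigD1 b) //= big1 ?addr0 => [|b' /negPf bb']; last first.
    by rewrite [b == b']eq_sym bb' andbF.
  by rewrite !eqxx.
apply: (eqr2_sum piP) => a' _; rewrite mulr_sumr mulr_suml.
by apply: (eqr2_sum piP) => b' _; apply: sandwich.
Qed.

End ArrowBimodule.

(** * Extensions of S_i by S_j *)

Lemma linear_exists (M N : lmodType A) (f : M -> N) :
  linear f -> exists g : {linear M -> N}, f = g.
Proof.
move=> fL; pose fP := GRing.isLinear.Build A M N *:%R f fL.
by pose g : {linear M -> N} := HB.pack f fP; exists g.
Qed.

Lemma coord_corner x : r x -> K (ej * x * ei) = K x.
Proof.
move=> rx; rewrite (coord_congr _ (coordE rx)); last first.
  by apply: (subspace_sum (rad_subspace piP)) => l _;
    apply: (subspaceZ (rad_subspace piP)); apply: coord_basis_rad.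
rewrite coord_sum => [|l]; last exact: coord_basis_rad.
by rewrite [RHS]row_sum_delta; apply: eq_bigr => l _; rewrite coord_basis.
Qed.

Lemma coord_cornerl x : r x -> K (ej * x) = K x.
Proof.
move=> rx; rewrite -coord_corner; last exact: (radMl piP).
rewrite -[RHS]coord_corner //; apply: coord_congr.
  by apply: (radMr piP); apply: (radMl piP).
rewrite !mulrA; apply: (eqr2Mr piP); apply: (eqr2_actl piP) => //.
by rewrite rmorphM /= !rliftK -phi_jM delta_mx_idem.
Qed.

Lemma coord_cornerr x : r x -> K (x * ei) = K x.
Proof.
move=> rx; rewrite -coord_corner; last exact: (radMr piP).
rewrite -[RHS]coord_corner //; apply: coord_congr.
  by apply: (radMr piP); apply: (radMl piP).
rewrite -!mulrA; apply: (eqr2Ml piP); apply: (eqr2_actr piP) => //.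
by rewrite rmorphM /= !rliftK -phi_iM delta_mx_idem.
Qed.

Section Ext.
Variables (Si Sj : lmodType A).
Hypotheses (Si_irr : irreducible_module Si) (Sj_irr : irreducible_module Sj)
  (Si1 : forall w : Si, Ei 1%:M *: w = w) (Sj1 : forall w : Sj, Ej 1%:M *: w = w).

Lemma cocycles_subspace (P : projective_resolution Si) :
  subspace (@ext1_cocycles k A Si Sj P).
Proof.
split=> [|c f f' [[g fg] f0] [[g' fg'] f'0]].
  split=> [|x //].
  have [|g gE] := @linear_exists (res_obj P 1%N) Sj (fun=> 0); last by exists g;
    rewrite -gE.
  by move=> a x z; rewrite scaler0 addr0.
split=> [|x]; last first.
  have -> : (c *: f + f') (res_diff P 1%N x)
      = c *: f (res_diff P 1%N x) + f' (res_diff P 1%N x) by [].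
  by rewrite f0 f'0 scaler0 addr0.
have [|h fh] := @linear_exists (res_obj P 1%N) Sj (fun t => (c%:A : A) *: (g t : Sj) + g' t).
  move=> a t t'; rewrite !linearP /= !scalerDr !scalerA addrACA; congr (_ + _ + _).
  by rewrite mulr_algl mulr_algr.
by exists h; rewrite -fh fg fg'.
Qed.

(* The inverse of the coordinate map: a functional on e_j (r/r^2) e_i with
   values at the y_l prescribed by [g] extends to an A-linear map r -> S_j. *)
Lemma corner_functional_extends (s : Sj) (g : 'rV[k]_m) : s <> 0 -> ej *: s = s ->
  exists G : A -> Sj,
    [/\ forall a x x', r x -> r x' -> G (a * x + x') = a *: G x + G x' &
        forall x, r x -> ej *: G x = ((K x *m g^T) 0 0)%:A *: s].
Proof.
move=> s0 es; pose th x := (K x *m g^T) 0 0.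
have thP n (c : 'I_n -> k) (x : 'I_n -> A) : (forall l, r (x l)) ->
    th (\sum_l c l *: x l) = \sum_l c l * th (x l).
  move=> rx; rewrite /th coord_sum // mulmx_suml summxE.
  by apply: eq_bigr => l _; rewrite -scalemxAl mxE.
have thD x x' : r x -> r x' -> th (x + x') = th x + th x'.
  by move=> rx rx'; rewrite /th -[x]scale1r coordP // !scale1r mulmxDl mxE.
have th_congr x x' : r x -> x' === x -> th x' = th x.
  by move=> rx /(coord_congr rx) xx'; rewrite /th xx'.
have rE p x : r x -> r (Ej (delta_mx oj p) * x) by move=> rx; apply: (radMl piP).
(* The formula is forced: E_op sends G x to G (E_op x), whose coefficient on [s] must be [th] of
   E_op x. *)
pose G x := (\sum_p th (Ej (delta_mx oj p) * x) *: Ej (delta_mx p oj)) *: s.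
exists G; split=> [a x x' rx rx'|x rx]; last first.
  rewrite /G scalerA -[s in RHS]es scalerA; apply: (irreducible_act piP Sj_irr).
  rewrite mulr_algl mulr_sumr (bigD1 oj) //= linearD /= [X in _ + X]linear_sum big1 /= ?addr0.
    rewrite -scalerAr !linearZ /= rmorphM /= rliftK -phi_jM delta_mx_idem.
    by rewrite /th coord_cornerl.
  move=> p /negPf pj; rewrite -scalerAr linearZ /= rmorphM /= !rliftK -phi_jM.
  by rewrite mul_delta_mx_cond eq_sym pj mulr0n linear0 scaler0.
rewrite /G scalerA -scalerDl; apply: (irreducible_act piP Sj_irr).
have [X XP] := block_coef phi_jM phi_j_ideal (pi a).
rewrite linearD /= rmorphM /= !linear_sum /= mulr_sumr.
under eq_bigr => p _ do rewrite linearZ /= rliftK.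
under [X in _ = X + _]eq_bigr => p _.
  rewrite linearZ /= rliftK -scalerAr (XP _).2 delta_mx_mulr linear_sum scaler_sumr.
  under eq_bigr => q _ do rewrite linearZ /= scalerA.
  over.
under [X in _ = _ + X]eq_bigr => p _ do rewrite linearZ /= rliftK.
rewrite exchange_big -big_split /=; apply: eq_bigr => p _.
rewrite -scaler_suml -scalerDl; congr (_ *: _).
rewrite mulrDr thD; [|by apply: rE; apply: (radMl piP)|exact: rE].
congr (_ + _); rewrite (@th_congr (\sum_q X p q *: (Ej (delta_mx oj q) * x))).
- by rewrite thP => [|q]; [apply: eq_bigr => q _; rewrite mulrC | exact: rE].
- by apply: (subspace_sum (rad_subspace piP)) => q _;
    apply: (subspaceZ (rad_subspace piP)); apply: rE.
have -> : \sum_q X p q *: (Ej (delta_mx oj q) * x) = (\sum_q X p q *: Ej (delta_mx oj q)) * x.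
  by rewrite mulr_suml; apply: eq_bigr => q _; rewrite scalerAl.
rewrite mulrA; apply: (eqr2_actl piP) => //.
rewrite rmorphM /= rliftK (XP _).1 delta_mx_mull !linear_sum.
by apply: eq_bigr => q _; rewrite !linearZ /= rliftK.
Qed.

(* With [L] the left annihilator of [x0], a map [L -> S_j] sends [a (1 - e_i)] to
   [a] times the image of [1 - e_i] and [a e_i] lies in [r], so modulo the
   restrictions of maps [A -> S_j] it is determined by its values on the [y l]. *)
Lemma annihilator_map_extends (x0 : Si) (h : A -> Sj) :
    x0 <> 0 -> ei *: x0 = x0 ->
    (forall a x x', x *: x0 = 0 -> x' *: x0 = 0 -> h (a * x + x') = a *: h x + h x') ->
    (forall l, ej *: h (y l) = 0) ->
  exists w, forall a, a *: x0 = 0 -> h a = a *: w.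
Proof.
move=> x00 ex0 hL hy.
have rL x : r x -> x *: x0 = 0 by move=> rx; apply: (irreducible_rad Si_irr).
have h0 : h 0 = 0.
  by have := hL (-1) 0 0; rewrite mulr0 addr0 scale0r scaleN1r addNr; apply.
have hM a x : x *: x0 = 0 -> h (a * x) = a *: h x.
  by move=> xL; rewrite -[_ * _]addr0 hL ?h0 ?addr0 // scale0r.
have hD x x' : x *: x0 = 0 -> x' *: x0 = 0 -> h (x + x') = h x + h x'.
  by move=> xL xL'; rewrite -[x]mul1r hL // mul1r scale1r.
(* The goal is that [h] vanishes on r: first on r^2 and the [y l], then on e_j r e_i, on r e_i, and
   on all of r. *)
pose N := [set x | r x /\ h x = 0].
have NB : add_subgroup N.
  split=> [|x x' [rx hx] [rx' hx']]; first by split=> //; exact: (rad0 piP).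
  split; first exact: (subspaceB (rad_subspace piP)).
  by rewrite addrC -mulN1r hL ?hx ?hx' ?scaler0 ?addr0 //; apply: rL.
have NM a x : N x -> N (a * x).
  by move=> [rx hx]; split; [exact: (radMl piP) | rewrite hM ?hx ?scaler0 //; exact: rL].
have r2N : r2 `<=` N.
  apply: smallest_sub => // _ [a ra [b rb ->]]; split; first exact: (radMl piP).
  by rewrite hM ?(irreducible_rad Sj_irr) //; apply: rL.
have N_congr x x' : N x -> x' === x -> N x'.
  by move=> Nx /r2N xx'; rewrite -[x'](subrK x); apply: add_subgroupD.
have Ny l : N (y l).
  have [ryl _] := coord_basis_corner l.
  split=> //; have [|_ hl] := r2N (y l - ej * y l).
    exact: corner_l (coord_basis_corner l).
  rewrite -[y l](subrK (ej * y l)) hD ?hl ?add0r; last 2 first.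
  - by apply: rL; apply: (rad2_rad piP); exact: corner_l (coord_basis_corner l).
  - by apply: rL; apply: (radMl piP).
  by rewrite hM ?hy //; apply: rL.
have hcorner x : r x -> h (ej * x * ei) = 0.
  move=> rx; have [] // : N (ej * x * ei).
  apply: N_congr (coordE rx); apply: add_subgroup_sum => // l _.
  by rewrite -[y l]mul1r scalerAl; apply: NM.
have hcornerr x : r x -> h (x * ei) = 0.
  move=> rx; rewrite -[h _]Sj1.
  (* The unit of A_j is the sum of E_po e_j E_op, and moving e_j E_op inside [h] leads to the
     corner. *)
  rewrite (@irreducible_act _ _ _ _ piP _ Sj_irr _
             (\sum_p Ej (delta_mx p oj) * ej * Ej (delta_mx oj p))).
    rewrite scaler_suml big1 // => p _; rewrite -!scalerA.
    rewrite -[Ej _ *: h _]hM; last by apply: rL; apply: (radMr piP).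
    rewrite -hM; last by apply: rL; apply: (radMl piP); apply: (radMr piP).
    rewrite [Ej (delta_mx oj p) * _]mulrA mulrA hcorner ?scaler0 //.
    exact: (radMl piP).
  rewrite rliftK mx1_sum_delta !linear_sum; apply: eq_bigr => p _.
  by rewrite !rmorphM /= !rliftK -!phi_jM !mul_delta_mx.
have eL : (1 - ei) *: x0 = 0 by rewrite scalerBl scale1r ex0 subrr.
have hrad x : r x -> h x = 0.
  (* As 1 - e_i annihilates [x0], h (x (1 - e_i)) = x h (1 - e_i), and r kills S_j. *)
  move=> rx; rewrite -[x]mulr1 -(subrK ei 1) mulrDr hD ?hcornerr ?addr0 //.
  - by rewrite hM // (irreducible_rad Sj_irr).
  - by rewrite -scalerA eL scaler0.
  - by apply: rL; apply: (radMr piP).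
exists (h (1 - ei)) => a aL.
have ra : r (a * ei) by apply: (corner_annihilator phi_iM phi_i_ideal Si_irr x00 ex0).
rewrite [a in LHS](_ : a = a * (1 - ei) + a * ei); last by rewrite mulrBr mulr1 subrK.
rewrite hD.
- by rewrite hM // (hrad (a * ei)) // addr0.
- by rewrite -scalerA eL scaler0.
- exact: rL.
Qed.

(* Comparing the given resolution with the surjection [A -> S_i], [a |-> a x0]. *)
Lemma ext1_dim_coordinates : ext1_dim Si Sj m.
Proof.
move=> P.
have [x0 [x00 ex0 _]] := corner_vector phi_iM phi_i_ideal oi Si_irr Si1.
have [s [s0 es sP]] := corner_vector phi_jM phi_j_ideal oj Sj_irr Sj1.
(* [tau w] is the coordinate of e_j w on the line spanned by [s]. *)
pose tau w := projT1 (cid (sP w)).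
have tauE w : ej *: w = (tau w)%:A *: s by rewrite /tau; case: cid.
have scal_inj (c d : k) : (c%:A : A) *: s = d%:A *: s -> c = d.
  move=> /eqP; rewrite -subr_eq0 -scalerBl -scalerBl => /eqP cds.
  apply/eqP; rewrite -subr_eq0; apply/negP => /negP cd; apply: s0.
  move/(congr1 (fun w => (c - d)^-1%:A *: w)): cds.
  by rewrite scaler0 scalerA mulr_algl scalerA mulVf // !scale1r.
have tauP c (w w' : Sj) : tau ((c%:A : A) *: w + w') = c * tau w + tau w'.
  apply: scal_inj; rewrite -tauE scalerDr.
  have -> : ej *: ((c%:A : A) *: w) = (c%:A : A) *: (ej *: w).
    by rewrite !scalerA mulr_algl mulr_algr.
  by rewrite !tauE scalerA mulr_algl scalerA -scalerDl -scalerDl.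
have tau0 : tau 0 = 0.
  by have := tauP (-1) 0 0; rewrite scaler0 addr0 mulN1r addNr.
pose P0 := res_obj P 0%N; pose P1 := res_obj P 1%N.
pose d0 : {linear P1 -> P0} := res_diff P 0%N.
pose aug : {linear P0 -> Si} := res_aug P.
have [act actE] : exists g : {linear A^o -> Si}, (fun a : A => a *: x0) = g.
  by apply: linear_exists => a b c; rewrite scalerDl scalerA.
have act_surj w : exists a, act a = w.
  by have [a ->] := irreducible_generator Si_irr w x00; exists a; rewrite -actE.
(* Comparison maps over S_i: [v] goes from P_0 to A, and [p0] below gives a map back, a to a p0. *)
have [v vE'] := res_projective aug act_surj.
have vE p : (v p : A) *: x0 = aug p by rewrite -vE' -actE.
have vM a p : v (a *: p) = a * (v p : A) by rewrite linearZ.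
have [p0 p0E] := res_aug_surj P x0.
have augP p : aug p = 0 <-> exists t, d0 t = p by exact: res_exact_aug.
have augd t : aug (d0 t) = 0 by apply/augP; exists t.
have zP l : exists t, d0 t = y l *: p0.
  apply/augP; rewrite linearZ /= p0E.
  by apply: (irreducible_rad Si_irr); apply: coord_basis_rad.
pose lifty l := projT1 (cid (zP l)).
have zE l : d0 (lifty l) = y l *: p0 by rewrite /lifty; case: cid.
pose W := P1 -> restrict_scalars Sj.
(* A cocycle induces a map on the annihilator of [x0]; its coordinates are the values at the [y l],
   read through the lifts [lifty l]. *)
pose c (f : W) : 'rV[k]_m := \row_l tau (f (lifty l)).
have cL : linear c.
  move=> a f f'; apply/rowP => l; rewrite !mxE.
  by rewrite -[(a *: f + f') (lifty l)]/((a%:A : A) *: (f (lifty l) : Sj) + f' (lifty l)) tauP.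
pose cP := GRing.isLinear.Build k W 'rV[k]_m *:%R c cL.
pose cl : {linear W -> 'rV[k]_m} := HB.pack c cP.
apply: (@dim_quotient_linear _ _ _ _ _ cl); first exact: cocycles_subspace.
- move=> f [[F fF] fd]; split=> [[_ [g ->] fg]|cf0].
    rewrite fg; apply/rowP => l; rewrite !mxE /= [res_diff P 0%N _]zE linearZ /=.
    by rewrite (irreducible_rad Sj_irr) //; apply: coord_basis_rad.
  have fz l : f (lifty l) = F (lifty l) by rewrite fF.
  have Fd t : F (res_diff P 1%N t) = 0 by rewrite -(fd t) fF.
  have FP t t' : d0 t = d0 t' -> F t = F t'.
    move=> tt'; have : d0 (t - t') = 0 by rewrite linearB /= tt' subrr.
    by move/res_exact => [q qE]; apply: subr0_eq; rewrite -linearB -qE Fd.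
  have DP p : exists w, forall t, d0 t = p -> F t = w.
    have [[t <-]|np] := pselect (exists t, d0 t = p).
      by exists (F t) => t' /FP.
    by exists 0 => t tp; case: np; exists t.
  (* By exactness the cocycle factors through [d0]; [D] is the induced map on the kernel of
     [aug]. *)
  pose D p := projT1 (cid (DP p)).
  have DE t : D (d0 t) = F t by rewrite /D; case: cid => w /= ->.
  have DL a p q : aug p = 0 -> aug q = 0 -> D (a *: p + q) = a *: D p + D q.
    move=> /augP[t <-] /augP[t' <-].
    by rewrite -[_ + _](linearP d0) !DE linearP.
  have augL a : a *: x0 = 0 -> aug (a *: p0) = 0 by rewrite linearZ /= p0E.
  have [||w wP] := @annihilator_map_extends x0 (fun a => D (a *: p0)) x00 ex0.
  - by move=> a b b' /augL bL /augL b'L; rewrite scalerDl -scalerA DL.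
  - move=> l; rewrite -zE DE -fz tauE.
    by move/rowP: cf0 => /(_ l); rewrite !mxE => ->; rewrite scale0r scale0r.
  have augv p : aug (p - (v p : A) *: p0) = 0.
    by rewrite linearB linearZ /= p0E vE subrr.
  (* Splitting p as (p - v(p) p0) + v(p) p0 extends [D] to P_0: the first summand lies in the kernel
     of [aug], and on the second the extension is v(p) w. This agrees with [D] on that kernel
     because there v(p) annihilates [x0]. *)
  have [|g gE] := @linear_exists P0 Sj
      (fun p => D (p - (v p : A) *: p0) + (v p : A) *: w).
    move=> a p q; rewrite linearP /= scalerDr addrACA; congr (_ + _); last first.
      by rewrite scalerDl !scalerA.
    rewrite -DL //; congr (D _).
    by rewrite scalerBr scalerDl opprD addrACA !scalerA.
  exists g; first by exists g.
  rewrite fF; apply/funext => t; rewrite /= -gE -/d0 -DE -wP ?vE ?augd //.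
  rewrite -[X in X + _]scale1r -DL // ?scale1r ?subrK //.
  by apply: augL; rewrite vE augd.
- move=> g; have [G [GL GE]] := corner_functional_extends g s0 es.
  have rann a : a *: x0 = 0 -> r (a * ei).
    by move=> aL; apply: (corner_annihilator phi_iM phi_i_ideal Si_irr x00 ex0).
  have rv t : r ((v (d0 t) : A) * ei) by apply: rann; rewrite vE augd.
  (* The element v (d0 t) annihilates [x0], so right multiplication by e_i sends it into r, where
     [G] is linear. *)
  have [|F FE] := @linear_exists P1 Sj (fun t => G ((v (d0 t) : A) * ei)).
    by move=> a t t'; rewrite linearP linearP /= mulrDl -mulrA GL.
  exists (F : P1 -> Sj).
    split; first by exists F.
    move=> t; rewrite -FE.
    have -> : d0 (res_diff P 1%N t) = 0 by apply/res_exact; exists t.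
    rewrite linear0 mul0r; have /= := GL (-1) 0 0 (rad0 piP) (rad0 piP).
    by rewrite mulr0 addr0 scaleN1r addNr.
  apply/rowP => l; rewrite mxE; apply: scal_inj; rewrite -tauE -FE GE //.
  congr (_%:A *: _); have ryl := coord_basis_rad l.
  (* Since v(p0) - 1 annihilates [x0], v(p0) e_i is e_i modulo r; hence y_l v(p0) e_i is y_l e_i
     modulo r^2. *)
  have r1 : r ((v p0 : A) * ei - ei).
    rewrite -[X in _ - X]mul1r -mulrBl; apply: rann.
    by rewrite scalerBl scale1r vE p0E subrr.
  rewrite zE vM (@coord_congr (y l * ei)).
  + by rewrite coord_cornerr // coord_basis -rowE !mxE.
  + exact: (radMr piP).
  by rewrite -mulrA /eqr2 -mulrBr; apply: rad2M.
Qed.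

End Ext.
End Coordinates.
End Corner.

(** * Units of blocks, the ceiling, and the conclusion *)

(** Of the block components of 1, only the one in A_i acts nontrivially on S_i, hence as the
    identity; multiplying it by the matrix unit element of A_i does not change it. *)
Lemma block_unit_acts (k : fieldType) (A B : algType k) (pi : {lrmorphism A -> B})
    (piP : radical_quotient pi) (s : nat) (blk : 'I_s -> set B)
    (S : 'I_s -> lmodType A) (i : 'I_s) (n : nat) (phi : {linear 'M[k]_n -> B}) :
    block_decomposition blk -> modules_of_blocks pi blk S ->
    irreducible_module (S i) ->
    (forall X Y, phi (X *m Y) = phi X * phi Y) -> range phi = blk i ->
  forall w : S i, rlift piP (phi 1%:M) *: w = w.
Proof.
move=> [_ /(_ 1)[u [[ublk u1] _]]] Sblk Sirr phiM phiE.
have act := irreducible_act piP Sirr.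
have [Y _ Yu] : range phi (u i) by rewrite phiE.
have Y1 (w : S i) : rlift piP (phi Y) *: w = w.
  rewrite -[RHS]scale1r (act 1 (\sum_l rlift piP (u l))); last first.
    by rewrite rmorph1 linear_sum u1; apply: eq_bigr => l _; rewrite /= rliftK.
  rewrite scaler_suml (bigD1 i) //= big1 ?addr0 ?Yu // => l li.
  by apply: (Sblk i l) => //; rewrite rliftK.
move=> w; rewrite -[LHS]Y1 scalerA (act _ (rlift piP (phi Y))) ?Y1 //.
by rewrite rmorphM /= !rliftK -phiM mulmx1.
Qed.

(** The least [t] with m <= t N satisfies t - 1 < m / N <= t, which characterises the ceiling. *)
Lemma ceil_ratio (m N : nat) : (0 < N)%N ->
  exists t : nat, [/\ (m <= t * N)%N, forall u, (m <= u * N)%N -> (t <= u)%N &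
    t%:Z = Num.ceil (m%:R / N%:R : rat)].
Proof.
move=> N0; have ex : exists t, (m <= t * N)%N by exists m; apply: leq_pmulr.
case: (ex_minnP ex) => t mt tmin; exists t; split=> //.
apply/esym/eqP; rewrite ceil_eq ltr_pdivlMr ?ltr0n // ler_pdivrMr ?ltr0n //.
rewrite -[t%:~R]/(t%:R) -natrM ler_nat mt andbT.
case: t {mt} tmin => [|t] tmin.
  by apply: lt_le_trans (ler0n _ _); rewrite mulN1r oppr_lt0 ltr0n.
rewrite intS addrC addKr -[t%:~R]/(t%:R) -natrM ltr_nat ltnNge.
by apply/negP => /tmin; rewrite ltnn.
Qed.

Theorem theorem2p2 (k : fieldType) (A : algType k)
  (artA : left_artinian A)
  (Abar : algType k) (pi : {lrmorphism A -> Abar})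
  (piP : radical_quotient pi)
  (s : nat) (blk : 'I_s -> set Abar)
  (blkP : block_decomposition blk)
  (n : 'I_s -> nat) (nP : forall i, matrix_block (blk i) (n i))
  (S : 'I_s -> lmodType A)
  (SP : complete_irreducibles S)
  (S_blk : modules_of_blocks pi blk S)
  (S_split : splitting S)
  (i j : 'I_s) :
  exists m t : nat,
    [/\ ext_quiver_arrows S i j m,
        natural_quiver_arrows pi blk i j t &
        t%:Z = Num.ceil (m%:R / (n i * n j)%:R : rat)].
Proof.
have blk_ideal l : two_sided_ideal (blk l) by have [] := blkP.1 l.
(* A block of size 0 would be the zero ideal, which is excluded by minimality; this provides the
   indices [oi] and [oj]. *)
have n_gt0 l : (0 < n l)%N.
  rewrite lt0n; apply/eqP => nl0; have [_ + _] := blkP.1 l; apply.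
  have [phi [_ <- _]] := nP l; apply/seteqP; split=> [_ [X _ <-]|_ ->].
    suff -> : X = 0 by rewrite /= linear0.
    by apply/matrixP => p; have := ltn_ord p; rewrite [X in (_ < X)%N]nl0.
  by exists 0; rewrite ?linear0.
have [phi_i [_ iE phi_iM]] := nP i; have [phi_j [_ jE phi_jM]] := nP j.
have phi_iI : two_sided_ideal (range phi_i) by rewrite iE.
have phi_jI : two_sided_ideal (range phi_j) by rewrite jE.
pose oi := Ordinal (n_gt0 i); pose oj := Ordinal (n_gt0 j).
have [m [y [K KP]]] :=
  corner_coordinates_exist piP phi_iM phi_jM phi_jI oi oj artA.
have [Sirr _ _] := SP.
have [|t [mt tmin tE]] := @ceil_ratio m (n i * n j); first by rewrite muln_gt0 !n_gt0.
exists m, t; split=> //.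
  apply: (ext1_dim_coordinates phi_iM phi_jM phi_iI phi_jI KP) => //.
    exact: (block_unit_acts piP blkP S_blk).
  exact: (block_unit_acts piP blkP S_blk).
split; first by apply: (generators_exist phi_iM phi_jM phi_iI phi_jI KP) => //;
  rewrite [(n j * _)%N]mulnC.
move=> u x xgen; apply: tmin; rewrite [(n i * _)%N]mulnC.
exact: (generators_lower_bound phi_iM phi_jM phi_iI phi_jI KP) xgen.
Qed.
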